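(* Consider the DSA algorithm described in the context, under conditions (a)–(c) on the weights and assuming every $f_{n,i}$ is differentiable and $\mu$-strongly convex with $L$-Lipschitz gradient. Let $\eta$ be any constant with $$\eta\in\left(\frac{L^2q_{\max}}{\mu q_{\min}}+\frac{L^2}{\mu}-L,\ \infty\right),$$ let the stepsize satisfy $\alpha\in(0,\gamma/(2\eta))$, and let $c$ be any constant with $$c\in\left(\frac{4\alpha Lq_{\max}}{\eta},\ \frac{4\alpha\mu q_{\min}}{L}-\frac{2\alpha q_{\min}(2L-\mu)}{\eta}\right).$$ Then there exists a constant $0<\delta<1$ such that for all $t$, $$\mathbb{E}\left[\|\mathbf{u}^{t+1}-\mathbf{u}^*\|_{\mathbf{G}}^2+c\,p^{t+1}\mid\mathcal{F}^t\right]\le(1-\delta)\left(\|\mathbf{u}^t-\mathbf{u}^*\|_{\mathbf{G}}^2+c\,p^t\right).$$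
   Context: Problem: a connected network of $N$ nodes; node $n$ holds $q_n$ functions $f_{n,i}:\mathbb{R}^p\to\mathbb{R}$, each differentiable, $\mu$-strongly convex, with $L$-Lipschitz gradient; $f_n:=\frac1{q_n}\sum_i f_{n,i}$, $\tilde{\mathbf{x}}^*:=\arg\min_{\mathbf{x}}\sum_n f_n(\mathbf{x})$; $q_{\min}:=\min_n q_n$, $q_{\max}:=\max_n q_n$. For $\mathbf{x}=[\mathbf{x}_1;\dots;\mathbf{x}_N]\in\mathbb{R}^{Np}$, $f(\mathbf{x}):=\sum_n f_n(\mathbf{x}_n)$, $\mathbf{x}^*:=[\tilde{\mathbf{x}}^*;\dots;\tilde{\mathbf{x}}^*]$. Weights: $\mathbf{W},\tilde{\mathbf{W}}\in\mathbb{R}^{N\times N}$ with entries nonzero only for $m=n$ or $m$ a neighbor of $n$, satisfying (a) symmetry; (b) $\mathrm{null}(\mathbf{I}-\tilde{\mathbf{W}})\supseteq\mathrm{span}(\mathbf{1})$, $\mathrm{null}(\mathbf{I}-\mathbf{W})=\mathrm{span}(\mathbf{1})$, $\mathrm{null}(\tilde{\mathbf{W}}-\mathbf{W})=\mathrm{span}(\mathbf{1})$; (c) $\mathbf{W}\preceq\tilde{\mathbf{W}}\preceq(\mathbf{I}+\mathbf{W})/2$, $\tilde{\mathbf{W}}\succ0$. $\mathbf{Z}:=\mathbf{W}\otimes\mathbf{I}_p$, $\tilde{\mathbf{Z}}:=\tilde{\mathbf{W}}\otimes\mathbf{I}_p$, $\mathbf{U}:=(\tilde{\mathbf{Z}}-\mathbf{Z})^{1/2}$;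 $\gamma$ is the smallest eigenvalue of $\tilde{\mathbf{Z}}$. DSA: stepsize $\alpha>0$, initial $\mathbf{x}_n^0$, $\mathbf{y}_{n,i}^0=\mathbf{x}_n^0$. At each $t\ge0$ node $n$ draws $i_n^t$ uniformly from $\{1,\dots,q_n\}$ independently of the past, sets $\hat{\mathbf{g}}_n^t:=\nabla f_{n,i_n^t}(\mathbf{x}_n^t)-\nabla f_{n,i_n^t}(\mathbf{y}_{n,i_n^t}^t)+\frac1{q_n}\sum_{i}\nabla f_{n,i}(\mathbf{y}_{n,i}^t)$, and $\mathbf{y}_{n,i}^{t+1}=\mathbf{x}_n^t$ if $i=i_n^t$, else $\mathbf{y}_{n,i}^{t+1}=\mathbf{y}_{n,i}^t$. With $\hat{\mathbf{g}}^t:=[\hat{\mathbf{g}}_1^t;\dots;\hat{\mathbf{g}}_N^t]$: $\mathbf{x}^1=\mathbf{Z}\mathbf{x}^0-\alpha\hat{\mathbf{g}}^0$, $\mathbf{x}^{t+1}=(\mathbf{I}+\mathbf{Z})\mathbf{x}^t-\tilde{\mathbf{Z}}\mathbf{x}^{t-1}-\alpha[\hat{\mathbf{g}}^t-\hat{\mathbf{g}}^{t-1}]$ for $t\ge1$. Dual variables $\mathbf{v}^t:=\sum_{s=0}^t\mathbf{U}\mathbf{x}^s$; $\mathbf{v}^*$ is the vector in the column space of $\mathbf{U}$ with $\alpha\nabla f(\mathbf{x}^* )+\mathbf{U}\mathbf{v}^*=\mathbf{0}$. $\mathbf{u}^t:=[\mathbf{x}^t;\mathbf{v}^t]$, $\mathbf{u}^*:=[\mathbf{x}^*;\mathbf{v}^*]$,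 $\mathbf{G}:=\mathrm{diag}(\tilde{\mathbf{Z}},\mathbf{I})$, $\|\mathbf{z}\|_{\mathbf{G}}^2:=\mathbf{z}^T\mathbf{G}\mathbf{z}$. $\mathcal{F}^t$ is the sigma-algebra of the history up to time $t$. Define $$p^t:=\sum_{n=1}^N\frac1{q_n}\sum_{i=1}^{q_n}\left(f_{n,i}(\mathbf{y}_{n,i}^t)-f_{n,i}(\tilde{\mathbf{x}}^* )-\nabla f_{n,i}(\tilde{\mathbf{x}}^* )^T(\mathbf{y}_{n,i}^t-\tilde{\mathbf{x}}^* )\right).$$ *)

(* Defs.v *)
From HB Require Import structures.
From mathcomp Require Import all_boot all_order all_algebra.
From mathcomp Require Import all_classical all_reals.
From mathcomp Require Import topology normedtype derive.
Set Implicit Arguments. Unset Strict Implicit. Unset Printing Implicit Defensive.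
Import Order.TTheory GRing.Theory Num.Theory.
Import numFieldNormedType.Exports.
Local Open Scope ring_scope.

Section DSA.
Variable R : realType.

Definition dotv (p : nat) (u v : 'rV[R]_p) : R := \sum_(k < p) u 0 k * v 0 k.
Definition enorm (p : nat) (u : 'rV[R]_p) : R := Num.sqrt (dotv u u).

Definition grad (p : nat) (f : 'rV[R]_p -> R) (x : 'rV[R]_p) : 'rV[R]_p :=
  \row_(k < p) ('d f x (\row_(j < p) (j == k)%:R : 'rV[R]_p)).

Definition strongly_convex (p : nat) (mu : R) (f : 'rV[R]_p -> R) : Prop :=
  forall (x y : 'rV[R]_p) (th : R), 0 <= th <= 1 ->
    f (th *: x + (1 - th) *: y) <=
      th * f x + (1 - th) * f y - mu / 2 * th * (1 - th) * (enorm (x - y)) ^+ 2.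

Definition lipschitz_grad (p : nat) (L : R) (f : 'rV[R]_p -> R) : Prop :=
  forall x y : 'rV[R]_p, enorm (grad f x - grad f y) <= L * enorm (x - y).

Definition psd (N : nat) (A : 'M[R]_N) : Prop :=
  forall u : 'cV[R]_N, 0 <= (u^T *m A *m u) 0 0.
Definition pd (N : nat) (A : 'M[R]_N) : Prop :=
  forall u : 'cV[R]_N, u != 0 -> 0 < (u^T *m A *m u) 0 0.
Definition loewner_le (N : nat) (A B : 'M[R]_N) : Prop := psd (B - A).
Definition null_eq_span1 (N : nat) (A : 'M[R]_N) : Prop :=
  forall u : 'cV[R]_N, A *m u = 0 <-> exists a : R, u = a *: const_mx 1.
Definition null_sup_span1 (N : nat) (A : 'M[R]_N) : Prop :=
  A *m (const_mx 1 : 'cV[R]_N) = 0.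
Definition is_psd_sqrt (N : nat) (A S : 'M[R]_N) : Prop :=
  S^T = S /\ psd S /\ S *m S = A.
Definition smallest_eigenvalue (N : nat) (A : 'M[R]_N) (g : R) : Prop :=
  eigenvalue A g /\ forall l : R, eigenvalue A l -> g <= l.

Variables (N p : nat) (q : 'I_N -> nat).
Variable F : forall n : 'I_N, 'I_(q n) -> 'rV[R]_p -> R.
Variables (W Wt Ur : 'M[R]_N) (alpha : R).

Definition fnode (n : 'I_N) (x : 'rV[R]_p) : R :=
  (q n)%:R^-1 * \sum_(i < q n) F i x.

(** a joint draw (i_1^t, ..., i_N^t) *)
Definition choice_t := {dffun forall n : 'I_N, 'I_(q n)}.

(** Stacked vectors of R^{Np} are represented as N x p matrices whose n-th row
    is the n-th block; then (A (x) I_p) x corresponds to A *m X. *)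
Record state := St {
  st_x : 'M[R]_(N, p);
  st_xprev : 'M[R]_(N, p);                    (* x^{t-1} (unused at t = 0) *)
  st_y : forall n : 'I_N, 'I_(q n) -> 'rV[R]_p;
  st_gprev : 'M[R]_(N, p);                    (* ghat^{t-1} (unused at t = 0) *)
  st_v : 'M[R]_(N, p)
}.

Definition ghat (s : state) (j : choice_t) : 'M[R]_(N, p) :=
  \matrix_(n < N)
    (grad (F (j n)) (row n (st_x s)) - grad (F (j n)) (st_y s (j n))
     + (q n)%:R^-1 *: \sum_(i < q n) grad (F i) (st_y s i)).

Definition init_state (x0 : 'M[R]_(N, p)) : state :=
  St x0 x0 (fun n _ => row n x0) 0 (Ur *m x0).

Definition dsa_step (t : nat) (s : state) (j : choice_t) : state :=
  let g := ghat s j in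
  let xn := if t == 0%N then W *m st_x s - alpha *: g
            else (1%:M + W) *m st_x s - Wt *m st_xprev s
                 - alpha *: (g - st_gprev s) in
  St xn (st_x s)
     (fun n i => if i == j n then row n (st_x s) else st_y s i)
     g (st_v s + Ur *m xn).

Fixpoint dsa (x0 : 'M[R]_(N, p)) (ch : nat -> choice_t) (t : nat) : state :=
  match t with
  | 0 => init_state x0
  | t'.+1 => dsa_step t' (dsa x0 ch t') (ch t')
  end.

(** ||u - u*||_G^2 with G = diag(Zt, I) *)
Definition Gnorm2 (s : state) (xs : 'rV[R]_p) (vs : 'M[R]_(N, p)) : R :=
  let D := st_x s - \matrix_(n < N) xs in
  let E := st_v s - vs in
  \sum_(n < N) \sum_(m < N) Wt n m * dotv (row n D) (row m D)
  + \sum_(n < N) dotv (row n E) (row n E).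

Definition pfun (s : state) (xs : 'rV[R]_p) : R :=
  \sum_(n < N) (q n)%:R^-1 *
    \sum_(i < q n) (F i (st_y s i) - F i xs
                    - dotv (grad (F i) xs) (st_y s i - xs)).

Definition lyap (c : R) (s : state) (xs : 'rV[R]_p) (vs : 'M[R]_(N, p)) : R :=
  Gnorm2 s xs vs + c * pfun s xs.

Definition ch_upd (ch : nat -> choice_t) (t : nat) (j : choice_t) :=
  fun s => if s == t then j else ch s.

(** E[ Phi(state^{t+1}) | F^t ]: average over the (uniform, independent) draw
    at time t, the past draws being fixed. *)
Definition cond_exp_next (x0 : 'M[R]_(N, p)) (ch : nat -> choice_t) (t : nat)
    (Phi : state -> R) : R :=
  #|{: choice_t}|%:R^-1 * \sum_(j : choice_t) Phi (dsa x0 (ch_upd ch t j) t.+1).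

End DSA.

(* Main.v *)
(** Summing the recursion gives the primal-dual form
    x^{t+1} = Wt x^t - alpha ghat^t - U v^t,  v^{t+1} = v^t + U x^{t+1}.
    Subtracting the optimality conditions, the cross terms in v cancel, and Young's
    inequality with parameter 2 eta bounds the increase of ||u^t - us||_G^2 by
      - (gamma - 2 alpha eta) |x^{t+1} - x^t|^2 - 2 alpha <x^t - xs, g> + alpha / (2 eta) |g|^2
    where g = ghat^t - grad f(xs).  With D the Bregman divergence of f between x^t and xs,
    E|g|^2 <= 4 L (D + p^t), E<x^t - xs, g> >= (2 mu / L) D and
    E p^{t+1} <= (1 - 1/qmax) p^t + D / qmin, so the conditions on alpha and c leave a
    strict decrease proportional to D + p^t + E|x^{t+1} - x^t|^2.  This quantity dominates
    ||u^t - us||_G^2 + c p^t up to a constant: v^t - vs lies in the range of U, where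
    |v| <= K |U v|, and U (v^t - vs) is read off the recursion. *)

Require Import Defs.
From HB Require Import structures.
From mathcomp Require Import all_boot all_order all_algebra.
From mathcomp Require Import all_classical all_reals.
From mathcomp Require Import topology normedtype derive.
From mathcomp Require Import ring lra.
Import Order.TTheory GRing.Theory Num.Theory.
Import numFieldNormedType.Exports.
Local Open Scope ring_scope.

(** * The Frobenius inner product of matrices *)

(** On stacked vectors, stored as N x p matrices, this is the Euclidean inner product of R^{Np};
    single rows and columns are covered by the same lemmas. *)
Definition mxdot {R : realType} {m n : nat} (A B : 'M[R]_(m, n)) : R :=
  \sum_(i < m) \sum_(j < n) A i j * B i j.

Lemma mxdot_tr {R : realType} {m n : nat} (A B : 'M[R]_(m, n)) :
  mxdot A B = \tr (A^T *m B).
Proof.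
rewrite /mxdot exchange_big; apply: eq_bigr => j _; rewrite mxE.
by apply: eq_bigr => i _; rewrite mxE.
Qed.

Lemma mxdotC {R : realType} {m n : nat} (A B : 'M[R]_(m, n)) :
  mxdot A B = mxdot B A.
Proof. by apply: eq_bigr => i _; apply: eq_bigr => j _; rewrite mulrC. Qed.

Lemma mxdotDr {R : realType} {m n : nat} (A B C : 'M[R]_(m, n)) :
  mxdot A (B + C) = mxdot A B + mxdot A C.
Proof. by rewrite !mxdot_tr mulmxDr mxtraceD. Qed.

Lemma mxdotDl {R : realType} {m n : nat} (A B C : 'M[R]_(m, n)) :
  mxdot (A + B) C = mxdot A C + mxdot B C.
Proof. by rewrite mxdotC mxdotDr ![mxdot C _]mxdotC. Qed.

Lemma mxdotZr {R : realType} {m n : nat} (a : R) (A B : 'M[R]_(m, n)) :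
  mxdot A (a *: B) = a * mxdot A B.
Proof. by rewrite !mxdot_tr -scalemxAr mxtraceZ. Qed.

Lemma mxdotZl {R : realType} {m n : nat} (a : R) (A B : 'M[R]_(m, n)) :
  mxdot (a *: A) B = a * mxdot A B.
Proof. by rewrite mxdotC mxdotZr mxdotC. Qed.

Lemma mxdotNr {R : realType} {m n : nat} (A B : 'M[R]_(m, n)) :
  mxdot A (- B) = - mxdot A B.
Proof. by rewrite -scaleN1r mxdotZr mulN1r. Qed.

Lemma mxdotNl {R : realType} {m n : nat} (A B : 'M[R]_(m, n)) :
  mxdot (- A) B = - mxdot A B.
Proof. by rewrite -scaleN1r mxdotZl mulN1r. Qed.

Lemma mxdot0r {R : realType} {m n : nat} (A : 'M[R]_(m, n)) : mxdot A 0 = 0.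
Proof. by rewrite mxdot_tr mulmx0 mxtrace0. Qed.

Lemma mxdot_sumr {R : realType} {m n : nat} (I : finType) (A : 'M[R]_(m, n))
    (B : I -> 'M[R]_(m, n)) :
  mxdot A (\sum_i B i) = \sum_i mxdot A (B i).
Proof. by rewrite mxdot_tr mulmx_sumr linear_sum; apply: eq_bigr => i _; rewrite mxdot_tr. Qed.

Definition mxdotE := (@mxdotDl, @mxdotDr, @mxdotNl, @mxdotNr, @mxdotZl, @mxdotZr).

Lemma mxdot_ge0 {R : realType} {m n : nat} (A : 'M[R]_(m, n)) : 0 <= mxdot A A.
Proof. by do 2![apply: sumr_ge0 => ? _]; rewrite -expr2 sqr_ge0. Qed.

Lemma mxdot_eq0 {R : realType} {m n : nat} (A : 'M[R]_(m, n)) :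
  mxdot A A = 0 -> A = 0.
Proof.
move=> A0; apply/matrixP => i j; rewrite mxE.
have h (k : 'I_m) : 0 <= \sum_(l < n) A k l * A k l.
  by apply: sumr_ge0 => ? _; rewrite -expr2 sqr_ge0.
have /(_ i isT) /psumr_eq0P e := psumr_eq0P (fun k _ => h k) A0.
by apply/eqP; rewrite -sqrf_eq0 expr2 e // => l _; rewrite -expr2 sqr_ge0.
Qed.

Lemma mxdot_mulmx {R : realType} {m n k : nat} (M : 'M[R]_(m, n))
    (A : 'M[R]_(m, k)) (B : 'M[R]_(n, k)) :
  mxdot A (M *m B) = mxdot (M^T *m A) B.
Proof. by rewrite !mxdot_tr trmx_mul trmxK mulmxA. Qed.

Lemma mxdot_rows {R : realType} {m n : nat} (A B : 'M[R]_(m, n)) :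
  mxdot A B = \sum_(i < m) mxdot (row i A) (row i B).
Proof.
apply: eq_bigr => i _; rewrite /mxdot big_ord1; apply: eq_bigr => j _.
by rewrite !mxE.
Qed.

Lemma mxdot_young {R : realType} {m n : nat} (k : R) (A B : 'M[R]_(m, n)) :
  0 < k -> - (2 * mxdot A B) <= k * mxdot A A + k^-1 * mxdot B B.
Proof.
move=> k0; have := mxdot_ge0 (A + k^-1 *: B).
rewrite -(pmulr_rge0 _ k0) !mxdotE [mxdot B A]mxdotC.
suff -> : k * (mxdot A A + k^-1 * mxdot A B +
      (k^-1 * mxdot A B + k^-1 * (k^-1 * mxdot B B)))
   = k * mxdot A A + k^-1 * mxdot B B + 2 * mxdot A B by lra.
by field; rewrite gt_eqF.
Qed.

Lemma mxdot_sqD {R : realType} {m n : nat} (A B : 'M[R]_(m, n)) :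
  mxdot (A + B) (A + B) <= 2 * mxdot A A + 2 * mxdot B B.
Proof.
by have := mxdot_ge0 (A - B); rewrite !mxdotE [mxdot B A]mxdotC; lra.
Qed.

Lemma mxdot_CS {R : realType} {m n : nat} (A B : 'M[R]_(m, n)) :
  mxdot A B ^+ 2 <= mxdot A A * mxdot B B.
Proof.
have := mxdot_ge0 B; rewrite le_eqVlt => /predU1P[/esym B0|B0].
  by rewrite (mxdot_eq0 B B0) !mxdot0r expr0n mulr0.
have := mxdot_ge0 (mxdot B B *: A - mxdot A B *: B).
rewrite !mxdotE [mxdot B A]mxdotC.
move=> h; rewrite -subr_ge0 -(pmulr_rge0 _ B0).
by apply: le_trans h _; rewrite le_eqVlt; apply/orP; left; apply/eqP; ring.
Qed.

(** Cauchy-Schwarz on each entry of [M *m A]: the Frobenius norm dominates the operator norm. *)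
Lemma mxdot_mulmx_le {R : realType} {m n : nat} (M : 'M[R]_(m, n)) (k : nat)
    (A : 'M[R]_(n, k)) :
  mxdot (M *m A) (M *m A) <= mxdot M M * mxdot A A.
Proof.
rewrite {1}/mxdot mulr_suml; apply: ler_sum => i _.
rewrite [mxdot A A](exchange_big) mulr_sumr; apply: ler_sum => j _.
have := mxdot_CS (row i M) (col j A)^T.
rewrite /mxdot !big_ord1 -expr2 !mxE => h.
apply: le_trans (le_trans h _); rewrite le_eqVlt; apply/orP; left; apply/eqP.
  by congr (_ ^+ 2); apply: eq_bigr => l _; rewrite !mxE.
by congr (_ * _); apply: eq_bigr => l _; rewrite !mxE.
Qed.

(** The trace form is a sum over the columns of [A], which lifts [psd] from column vectors to
    stacked ones. *)
Lemma mxdot_mulmx_ge0 {R : realType} {m k : nat} (M : 'M[R]_m) (A : 'M[R]_(m, k)) :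
  psd M -> 0 <= mxdot A (M *m A).
Proof.
move=> Mpsd; rewrite mxdot_tr; apply: sumr_ge0 => j _.
have := Mpsd (col j A); rewrite -mulmxA [(A^T *m _) j j]mxE mxE.
congr (_ <= _); apply: eq_bigr => i _; rewrite !mxE.
by congr (_ * _); apply: eq_bigr => l _; rewrite !mxE.
Qed.

(** * Least eigenvalue and range of a symmetric matrix *)

Lemma psdP {R : realType} {m : nat} (M : 'M[R]_m) :
  psd M <-> forall u : 'cV[R]_m, 0 <= mxdot u (M *m u).
Proof.
by split=> h u; have := h u; rewrite mxdot_tr mulmxA trace_mx11.
Qed.

(* Expanding the form at [u - tau M u] with [tau] the inverse of an upper bound
   of the form gives [|M u|^2 <= C <u, M u>]. *)
Lemma psd_unit_coercive {R : realType} {m : nat} (M : 'M[R]_m) :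
  M^T = M -> psd M -> M \in unitmx ->
  exists2 e : R, 0 < e & forall u : 'cV[R]_m, e * mxdot u u <= mxdot u (M *m u).
Proof.
move=> Ms /psdP Mp Mu.
pose C := 1 + mxdot M M; pose K := 1 + mxdot (invmx M) (invmx M).
have C0 : 0 < C by rewrite ltr_wpDr // mxdot_ge0.
have K0 : 0 < K by rewrite ltr_wpDr // mxdot_ge0.
exists (C * K)^-1; first by rewrite invr_gt0 mulr_gt0.
move=> u; set w := M *m u.
have upper (v : 'cV[R]_m) : mxdot v (M *m v) <= C * mxdot v v.
  have := mxdot_young 1 v (- (M *m v)) ltr01.
  have := mxdot_mulmx_le M 1 v; have := mxdot_ge0 v.
  have := mulr_ge0 (mxdot_ge0 M) (mxdot_ge0 v).
  rewrite !mxdotE invr1 /C; lra.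
have uw : mxdot u u <= K * mxdot w w.
  have := mxdot_mulmx_le (invmx M) 1 w; rewrite mulKmx // => h.
  by apply: le_trans h _; rewrite ler_wpM2r ?mxdot_ge0 // /K lerDr.
have key : mxdot w w <= C * mxdot u w.
  have := Mp (u - C^-1 *: w); rewrite mulmxBr -scalemxAr -/w !mxdotE.
  have -> : mxdot u (M *m w) = mxdot w w by rewrite mxdot_mulmx Ms.
  have := upper w; rewrite -(ler_pM2l (_ : 0 < C^-1 * C^-1)); last first.
    by rewrite mulr_gt0 // invr_gt0.
  have -> : C^-1 * C^-1 * (C * mxdot w w) = C^-1 * mxdot w w.
    by field; rewrite gt_eqF.
  move=> h1 h2; rewrite -(ler_pM2l (_ : 0 < C^-1)) ?invr_gt0 // mulKf ?gt_eqF //.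
  lra.
rewrite -(ler_pM2l (mulr_gt0 C0 K0)) mulVKf ?gt_eqF ?mulr_gt0 //.
apply: le_trans uw _; rewrite -mulrA [leRHS]mulrCA.
by rewrite ler_pM2l.
Qed.

(** No spectral decomposition is used: the largest [t] with [t |u|^2 <= <u, M u>] for all [u] is
    itself an eigenvalue, hence at least [g]. *)
Lemma smallest_eigenvalue_psd {R : realType} {m : nat} (M : 'M[R]_m) (g : R) :
  M^T = M -> psd M -> smallest_eigenvalue M g -> psd (M - g%:M).
Proof.
move=> Ms /psdP Mp [/eigenvalueP[v _ v0] gmin].
pose S : set R := [set t | forall u : 'cV[R]_m, t * mxdot u u <= mxdot u (M *m u)]%classic.
have S0 : S 0 by move=> u; rewrite mul0r.
have vv0 : 0 < mxdot v^T v^T.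
  rewrite lt_neqAle mxdot_ge0 andbT eq_sym; apply: contraNneq v0 => /mxdot_eq0 e.
  by rewrite -[v]trmxK e trmx0.
have Sb : has_sup S.
  split; first by exists 0.
  (* The Rayleigh quotient at a nonzero vector bounds [S] from above. *)
  exists (mxdot v^T (M *m v^T) / mxdot v^T v^T) => t St.
  by rewrite ler_pdivlMr.
have supS : S (sup S).
  move=> u; have := mxdot_ge0 u; rewrite le_eqVlt => /predU1P[<-|u0].
    by rewrite mulr0.
  rewrite -ler_pdivlMr //; apply: ge_sup; first by exists 0.
  by move=> t St; rewrite ler_pdivlMr.
have Apsd : psd (M - (sup S)%:M).
  apply/psdP => u; rewrite mulmxBl mul_scalar_mx !mxdotE subr_ge0; exact: supS.
suff /gmin gle : eigenvalue M (sup S).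
  apply/psdP => u; rewrite mulmxBl mul_scalar_mx !mxdotE subr_ge0.
  by apply: le_trans (supS u); rewrite ler_wpM2r ?mxdot_ge0.
(* If [M - sup S] were invertible it would be coercive, and [sup S] could be raised by the
   coercivity constant [e]. *)
rewrite /eigenvalue /eigenspace kermx_eq0 row_free_unit; apply/negP => Au.
have [|e e0 he] := psd_unit_coercive _ _ Apsd Au.
  by rewrite linearB /= tr_scalar_mx Ms.
have : S (sup S + e).
  move=> u; have := he u.
  by rewrite mulmxBl mul_scalar_mx !mxdotE; lra.
by move/(sup_upper_bound Sb); lra.
Qed.

Lemma pd_smallest_eigenvalue_gt0 {R : realType} {m : nat} (M : 'M[R]_m) (g : R) :
  M^T = M -> pd M -> smallest_eigenvalue M g -> 0 < g.
Proof.
move=> Ms Mp [/eigenvalueP[v vM v0] _].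
have := Mp v^T; rewrite trmxK vM -scalemxAl mxE.
have -> : v^T != 0 by apply: contraNneq v0 => e; rewrite -[v]trmxK e trmx0.
move=> /(_ isT); have -> : (v *m v^T) 0 0 = mxdot v^T v^T.
  by rewrite mxdot_tr trmxK trace_mx11.
move=> h; have [//|gle] := ltP 0 g.
by have := mulr_le0_ge0 gle (mxdot_ge0 v^T); rewrite leNgt h.
Qed.

(* [U] and [U ^+ 2] have the same row space when [U] is symmetric, so [U]
   factors through [U *m U]. *)
Lemma symmetric_range_bound {R : realType} {m : nat} (U : 'M[R]_m) :
  U^T = U -> exists2 K : R, 0 <= K & forall (k : nat) (w : 'M[R]_(m, k)),
    mxdot (U *m w) (U *m w) <= K * mxdot (U *m (U *m w)) (U *m (U *m w)).
Proof.
move=> Us; have /submxP[D DU] : (U <= U *m U)%MS.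
  rewrite submxE; apply/eqP/mxdot_eq0; set c := cokermx _.
  by rewrite mxdot_mulmx Us mulmxA mulmx_coker mxdotC mxdot0r.
exists (mxdot D D) => [|k w]; first exact: mxdot_ge0.
rewrite {1 2}DU -2!mulmxA; exact: mxdot_mulmx_le.
Qed.

(** * Smooth strongly convex functions *)

Lemma dotvE {R : realType} {p : nat} (u v : 'rV[R]_p) : dotv u v = mxdot u v.
Proof. by rewrite /mxdot big_ord1. Qed.

Lemma enorm_sqr {R : realType} {p : nat} (u : 'rV[R]_p) : enorm u ^+ 2 = mxdot u u.
Proof. by rewrite /enorm sqr_sqrtr dotvE ?mxdot_ge0. Qed.

Lemma mxdot_le_enorm {R : realType} {p : nat} (u v : 'rV[R]_p) :
  mxdot u v <= enorm u * enorm v.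
Proof.
have [|h] := leP (mxdot u v) 0; first by move/le_trans; apply; rewrite mulr_ge0 ?sqrtr_ge0.
by rewrite -ler_sqr ?nnegrE ?(ltW h) ?mulr_ge0 ?sqrtr_ge0 // exprMn !enorm_sqr mxdot_CS.
Qed.

(** Written with [dotv] so that the summands of [pfun] are instances of it by conversion. *)
Definition bregman {R : realType} {p : nat} (f : 'rV[R]_p -> R) (y x : 'rV[R]_p) : R :=
  f y - f x - dotv (grad f x) (y - x).

Lemma diff_grad {R : realType} {p : nat} (f : 'rV[R]_p -> R) (x v : 'rV[R]_p) :
  differentiable f x -> 'd f x v = mxdot (grad f x) v.
Proof.
move=> df; rewrite [in LHS](row_sum_delta v) linear_sum -dotvE /=.
apply: eq_bigr => k _; rewrite linearZ /= mxE [LHS]mulrC; congr ('d f x _ * _).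
by apply/rowP => j; rewrite !mxE eqxx.
Qed.

(** Strong convexity bounds the secant slopes from [x] towards [y]; they tend to the directional
    derivative. *)
Lemma strongly_convex_bregman {R : realType} {p : nat} (mu : R)
    (f : 'rV[R]_p -> R) (x y : 'rV[R]_p) :
  differentiable f x -> strongly_convex mu f ->
  mu / 2 * mxdot (y - x) (y - x) <= bregman f y x.
Proof.
move=> df sc; set d := y - x.
pose Q h := h^-1 *: (f (h *: d + x) - f x).
have cvQ : (Q h @[h --> (0 : R)^'] --> mxdot (grad f x) d)%classic.
  rewrite -diff_grad // -deriveE //; exact: (diff_derivable df).
(* Subtracting a term that vanishes with [h] makes the upper bound independent of [h], so it passes
   to the right limit. *)
have cvQ' : (Q h - mu / 2 * mxdot d d * h @[h --> (0 : R)^'+] -->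
    mxdot (grad f x) d - mu / 2 * mxdot d d * 0)%classic.
  apply: cvgB; first exact: cvg_dnbhs_at_right.
  by apply: cvg_at_right_filter; apply: cvgMr; exact: cvg_id.
have : mxdot (grad f x) d - mu / 2 * mxdot d d * 0 <= f y - f x - mu / 2 * mxdot d d.
  apply: cvgr_to_le cvQ' _; near=> h.
  have h0 : 0 < h by near: h; exact: nbhs_right_gt.
  have h1 : h <= 1 by near: h; exact: nbhs_right_le.
  have := sc y x h; rewrite (ltW h0) h1 => /(_ isT).
  have -> : h *: y + (1 - h) *: x = h *: d + x.
    by apply/rowP => k; rewrite !mxE; ring.
  rewrite enorm_sqr -/d => le.
  suff : Q h <= f y - f x - mu / 2 * (1 - h) * mxdot d d by lra.
  rewrite /Q -[_ *: _]/(_ * _) ler_pdivrMl //; lra.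
by rewrite /bregman dotvE -/d; lra.
Unshelve. all: by end_near. Qed.

Lemma bregman_ge0 {R : realType} {p : nat} (mu : R) (f : 'rV[R]_p -> R)
    (x y : 'rV[R]_p) :
  0 <= mu -> differentiable f x -> strongly_convex mu f -> 0 <= bregman f y x.
Proof.
move=> mu0 df sc; apply: le_trans (strongly_convex_bregman mu f x y df sc).
by rewrite mulr_ge0 ?mxdot_ge0 // divr_ge0.
Qed.

Lemma lipschitz_grad_mxdot {R : realType} {p : nat} (L : R) (f : 'rV[R]_p -> R)
    (x d : 'rV[R]_p) (h : R) :
  lipschitz_grad L f -> 0 <= h ->
  mxdot (grad f (x + h *: d) - grad f x) d <= L * h * mxdot d d.
Proof.
move=> lip h0; apply: le_trans (mxdot_le_enorm _ _) _.
have -> : L * h * mxdot d d = L * enorm (h *: d) * enorm d.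
  rewrite -[mxdot d d]enorm_sqr {2}/enorm dotvE !mxdotE mulrA -expr2.
  rewrite sqrtrM ?sqr_ge0 // sqrtr_sqr ger0_norm // -dotvE -/(enorm d); ring.
rewrite ler_wpM2r ?sqrtr_ge0 //.
have e : x + h *: d - x = h *: d by rewrite [x + _]addrC addrK.
rewrite -{2}e; exact: lip.
Qed.

(* Convexity bounds each increment of [f] along a subdivision of [[x, x + d]]
   by the slope at its right end. *)
Lemma subdivided_descent {R : realType} {p : nat} (mu L : R) (f : 'rV[R]_p -> R)
    (x d : 'rV[R]_p) (h : R) (k : nat) :
  0 <= mu -> (forall z, differentiable f z) -> strongly_convex mu f ->
  lipschitz_grad L f -> 0 <= h ->
  f (x + (k%:R * h) *: d) - f x - k%:R * h * mxdot (grad f x) d <=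
    L * h ^+ 2 * (k%:R * k.+1%:R / 2) * mxdot d d.
Proof.
move=> mu0 df sc lip h0; elim: k => [|k IH].
  by rewrite !mul0r scale0r addr0 subrr subr0 mulr0 mul0r.
set z := x + (k%:R * h) *: d in IH *; set z' := x + (k.+1%:R * h) *: d.
have zz' : z - z' = - (h *: d).
  by apply/rowP => i; rewrite !mxE -natr1; ring.
have := lipschitz_grad_mxdot L f x d (k.+1%:R * h) lip (mulr_ge0 (ler0n _ _) h0).
have := bregman_ge0 mu f z' z mu0 (df _) sc.
rewrite -/z' /bregman dotvE zz'.
move: IH; move: (grad f x) (grad f z') (f z) (f z') => g g' fz fz'.
rewrite !mxdotE => IH b /(ler_wpM2l h0) gd.
apply: le_trans (_ : _ <= L * h ^+ 2 * (k%:R * k.+1%:R / 2) * mxdot d d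
   + h * (L * (k.+1%:R * h) * mxdot d d)) _.
  move: IH gd b; rewrite -natr1; lra.
by rewrite le_eqVlt; apply/orP; left; apply/eqP; rewrite -!natr1; field.
Qed.

(** Subdividing the segment into [m + 1] equal pieces gives the bound up to a factor
    [1 + 1 / (m + 1)], which replaces integration of the gradient along the segment. *)
Lemma bregman_le {R : realType} {p : nat} (mu L : R) (f : 'rV[R]_p -> R)
    (x y : 'rV[R]_p) :
  0 <= mu -> 0 <= L -> (forall z, differentiable f z) -> strongly_convex mu f ->
  lipschitz_grad L f ->
  bregman f y x <= L / 2 * mxdot (y - x) (y - x).
Proof.
move=> mu0 L0 df sc lip; apply/ler_addgt0Pr => e e0.
set d := y - x; set c := L / 2 * mxdot d d.
have c0 : 0 <= c by rewrite mulr_ge0 ?mxdot_ge0 // divr_ge0.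
pose m := Num.bound (c / e).
have me : c / e < m.+1%:R.
  apply: lt_trans (_ : m%:R < _); last by rewrite ltr_nat.
  by rewrite archi_boundP // divr_ge0 // ltW.
have m0 : 0 < m.+1%:R :> R by rewrite ltr0n.
have m0' : m.+1%:R != 0 :> R by rewrite gt_eqF.
have := subdivided_descent mu L f x d m.+1%:R^-1 m.+1 mu0 df sc lip.
rewrite invr_ge0 (ltW m0) => /(_ isT).
rewrite divff // scale1r mul1r [x + d]addrC subrK.
have -> : L * m.+1%:R^-1 ^+ 2 * (m.+1%:R * m.+2%:R / 2) * mxdot d d
     = c + c / m.+1%:R by rewrite /c -[m.+2%:R]natr1; field.
rewrite /bregman dotvE -/d => h; apply: le_trans h _; rewrite lerD2l.
by rewrite ler_pdivrMr // mulrC -ler_pdivrMr // ltW.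
Qed.

(** The two quadratic bounds on the Bregman divergence are compared at a nonzero vector, which
    exists as [p] is positive. *)
Lemma strong_convexity_le_smoothness {R : realType} {p : nat} (mu L : R)
    (f : 'rV[R]_p -> R) :
  (0 < p)%N -> 0 <= mu -> 0 <= L -> (forall z, differentiable f z) ->
  strongly_convex mu f -> lipschitz_grad L f -> mu <= L.
Proof.
move=> p0 mu0 L0 df sc lip; pose v : 'rV[R]_p := const_mx 1.
have vv : 0 < mxdot (v - 0) (v - 0).
  rewrite lt_neqAle mxdot_ge0 andbT eq_sym subr0; apply/eqP => /mxdot_eq0.
  by move=> /rowP /(_ (Ordinal p0)); rewrite !mxE => /eqP; rewrite oner_eq0.
have := le_trans (strongly_convex_bregman mu f 0 v (df _) sc)
  (bregman_le mu L f 0 v mu0 L0 df sc lip).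
by rewrite ler_pM2r //; lra.
Qed.

(* [z - y] is a gradient step of length [1 / L] for the tilted function
   [f - <grad f x, _>], which is minimal at [x]. *)
Lemma grad_sub_sqr_le {R : realType} {p : nat} (mu L : R) (f : 'rV[R]_p -> R)
    (x y : 'rV[R]_p) :
  0 <= mu -> 0 < L -> (forall z, differentiable f z) -> strongly_convex mu f ->
  lipschitz_grad L f ->
  mxdot (grad f y - grad f x) (grad f y - grad f x) <= 2 * L * bregman f y x.
Proof.
move=> mu0 L0 df sc lip; set G := grad f y - grad f x.
pose z := y - L^-1 *: G.
have zx : z - x = (y - x) - L^-1 *: G by rewrite /z addrAC.
have zy : z - y = - (L^-1 *: G) by rewrite /z addrAC subrr sub0r.
have h2 u : z - x = u -> 0 <= f z - f x - mxdot (grad f x) u.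
  by move=> <-; rewrite -dotvE; exact: bregman_ge0 mu f x z mu0 (df _) sc.
have h1 u : z - y = u -> f z - f y - mxdot (grad f y) u <= L / 2 * mxdot u u.
  by move=> <-; rewrite -dotvE; exact: bregman_le mu L f y z mu0 (ltW L0) df sc lip.
rewrite /bregman dotvE; move: (h1 _ zy) (h2 _ zx).
have : mxdot G G = mxdot (grad f y) G - mxdot (grad f x) G by rewrite -mxdotNl -mxdotDl.
move: (grad f x) (grad f y) (f x) (f y) (f z) (G) => gx gy fx fy fz {h1 h2 zx zy z}G.
rewrite !mxdotE => Ge h1 h2.
have h3 : - - (L^-1 * (L^-1 * mxdot G G)) * (L / 2) = L^-1 * mxdot G G / 2.
  by rewrite opprK; field; rewrite gt_eqF.
have : L^-1 * mxdot G G <= 2 * (fy - fx - (mxdot gx y - mxdot gx x)).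
  have h4 : L^-1 * mxdot G G = L^-1 * mxdot gy G - L^-1 * mxdot gx G.
    by rewrite Ge mulrBr.
  move: h1 h2 h3 h4; lra.
by rewrite ler_pdivrMl //; lra.
Qed.

(** The right side is the sum of the divergences in both directions, hence at least [mu |y - x|^2];
    smoothness bounds [bregman f y x] by [L / 2 |y - x|^2]. *)
Lemma grad_monotone {R : realType} {p : nat} (mu L : R) (f : 'rV[R]_p -> R)
    (x y : 'rV[R]_p) :
  0 <= mu -> 0 < L -> (forall z, differentiable f z) -> strongly_convex mu f ->
  lipschitz_grad L f ->
  2 * mu / L * bregman f y x <= mxdot (y - x) (grad f y - grad f x).
Proof.
move=> mu0 L0 df sc lip.
have h1 : mu / 2 * mxdot (y - x) (y - x) <= f y - f x - mxdot (grad f x) (y - x).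
  by have := strongly_convex_bregman mu f x y (df _) sc; rewrite /bregman dotvE.
have h2 u : x - y = u -> mu / 2 * mxdot u u <= f x - f y - mxdot (grad f y) u.
  by move=> <-; have := strongly_convex_bregman mu f y x (df _) sc; rewrite /bregman dotvE.
have h3 := bregman_le mu L f x y mu0 (ltW L0) df sc lip.
have muL : 0 <= 2 * mu / L by rewrite divr_ge0 ?(ltW L0) // mulr_ge0.
have := ler_wpM2l muL h3.
have -> : 2 * mu / L * (L / 2 * mxdot (y - x) (y - x)) = mu * mxdot (y - x) (y - x).
  by field; rewrite gt_eqF.
move=> h; apply: le_trans h _; move: h1 (h2 _ (esym (opprB y x))).
move: (grad f x) (grad f y) (f x) (f y) (y - x) => gx gy fx fy d.
rewrite !mxdotE [mxdot d gx]mxdotC [mxdot d gy]mxdotC; lra.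
Qed.

(** * Averaging over the joint draw *)

Definition choice_mean {R : realType} {N : nat} {q : 'I_N -> nat}
    (Phi : choice_t q -> R) : R :=
  #|{: choice_t q}|%:R^-1 * \sum_(j : choice_t q) Phi j.

(* Exchanging the [n]-th coordinate of [j] with [i] is an involution of the
   pairs [(j, i)]. *)
Lemma sum_choice_coord {R : realType} {N : nat} {q : 'I_N -> nat} (n : 'I_N)
    (g : 'I_(q n) -> R) :
  (q n)%:R * \sum_(j : choice_t q) g (j n) = #|{: choice_t q}|%:R * \sum_i g i.
Proof.
pose sw (a : choice_t q * 'I_(q n)) : choice_t q * 'I_(q n) :=
  (finfun (@eqtype.dfwith _ (fun m => 'I_(q m)) a.1 n a.2) : choice_t q, a.1 n).
have swK : involutive sw.
  move=> [j i]; rewrite /sw /= ffunE dfwith_in; congr pair.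
  apply/ffunP => m; rewrite ffunE; case: (eqVneq n m) => [<-|nm].
    by rewrite dfwith_in.
  by rewrite dfwith_out // ffunE dfwith_out.
transitivity (\sum_(a : choice_t q * 'I_(q n)) g (a.1 n)).
  rewrite -(pair_bigA _ (fun (j : choice_t q) (i : 'I_(q n)) => g (j n))) mulr_sumr; apply: eq_bigr => j _ /=.
  by rewrite sumr_const card_ord mulr_natl.
rewrite (reindex_inj (inv_inj swK)) /=.
transitivity (\sum_(a : choice_t q * 'I_(q n)) g a.2).
  by apply: eq_bigr => -[j i] _ /=; rewrite ffunE dfwith_in.
by rewrite -(pair_bigA _ (fun (j : choice_t q) i => g i)) sumr_const mulr_natl.
Qed.

(** Each coordinate of a uniform joint draw is uniform. The premise [choice_t q] is a witness that
    joint draws exist, so that their number can be inverted. *)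
Lemma choice_mean_coords {R : realType} {N : nat} {q : 'I_N -> nat}
    (g : forall n : 'I_N, 'I_(q n) -> R) :
  choice_t q -> (forall n, (0 < q n)%N) ->
  choice_mean (fun j => \sum_(n < N) g n (j n)) =
  \sum_(n < N) (q n)%:R^-1 * \sum_(i < q n) g n i.
Proof.
move=> j0 q0; rewrite /choice_mean exchange_big mulr_sumr; apply: eq_bigr => n _.
have c0 : #|{: choice_t q}|%:R != 0 :> R by rewrite pnatr_eq0 -lt0n; apply/card_gt0P; exists j0.
have qn0 : (q n)%:R != 0 :> R by rewrite pnatr_eq0 -lt0n.
apply: (mulfI c0); rewrite mulVKf //; apply: (mulfI qn0).
by rewrite sum_choice_coord mulrCA; congr (_ * _); rewrite mulVKf.
Qed.

Lemma choice_mean_le {R : realType} {N : nat} {q : 'I_N -> nat}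
    (Phi Psi : choice_t q -> R) :
  (forall j, Phi j <= Psi j) -> choice_mean Phi <= choice_mean Psi.
Proof. by move=> h; rewrite ler_wpM2l ?invr_ge0 ?ler0n // ler_sum. Qed.

Lemma choice_meanD {R : realType} {N : nat} {q : 'I_N -> nat}
    (Phi Psi : choice_t q -> R) :
  choice_mean (fun j => Phi j + Psi j) = choice_mean Phi + choice_mean Psi.
Proof. by rewrite /choice_mean big_split mulrDr. Qed.

Lemma choice_meanZ {R : realType} {N : nat} {q : 'I_N -> nat} (a : R)
    (Phi : choice_t q -> R) :
  choice_mean (fun j => a * Phi j) = a * choice_mean Phi.
Proof. by rewrite /choice_mean -mulr_sumr mulrCA. Qed.

Lemma choice_mean_cst {R : realType} {N : nat} {q : 'I_N -> nat} (a : R) :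
  choice_t q -> choice_mean (fun _ : choice_t q => a) = a.
Proof.
move=> j0; rewrite /choice_mean sumr_const -[a *+ _]mulr_natl mulKf //.
by rewrite pnatr_eq0 -lt0n; apply/card_gt0P; exists j0.
Qed.

(** Split as [X i] plus [m - Y i]; since [m] is the mean of the [Y i], the second part is a
    variance, bounded by the second moment. *)
Lemma saga_second_moment {R : realType} {p k : nat} (X Y : 'I_k -> 'rV[R]_p)
    (m : 'rV[R]_p) :
  (0 < k)%N -> m = k%:R^-1 *: \sum_i Y i ->
  \sum_i mxdot (X i - Y i + m) (X i - Y i + m) <=
    2 * \sum_i mxdot (X i) (X i) + 2 * \sum_i mxdot (Y i) (Y i).
Proof.
move=> k0 mE; rewrite !mulr_sumr -big_split /=.
have kne : k%:R != 0 :> R by rewrite pnatr_eq0 -lt0n.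
have var : \sum_i mxdot (m - Y i) (m - Y i) <= \sum_i mxdot (Y i) (Y i).
  have sY : \sum_i mxdot m (Y i) = k%:R * mxdot m m.
    by rewrite -mxdot_sumr -mxdotZr {3}mE scalerA divff // scale1r.
  have -> : \sum_i mxdot (m - Y i) (m - Y i) =
      k%:R * mxdot m m - 2 * \sum_i mxdot m (Y i) + \sum_i mxdot (Y i) (Y i).
    have -> : k%:R * mxdot m m = \sum_(i < k) mxdot m m.
      by rewrite sumr_const card_ord mulr_natl.
    rewrite [2 * _]mulr_sumr -sumrB -big_split /=.
    apply: eq_bigr => i _; rewrite !mxdotE [mxdot (Y i) m]mxdotC; ring.
  rewrite sY; have := mulr_ge0 (ler0n R k) (mxdot_ge0 m); lra.
apply: le_trans (_ : _ <= \sum_i (2 * mxdot (X i) (X i)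
    + 2 * mxdot (m - Y i) (m - Y i))) _.
  by apply: ler_sum => i _; rewrite -addrA [- _ + m]addrC mxdot_sqD.
by rewrite !big_split /= lerD2l -!mulr_sumr ler_pM2l.
Qed.

(** * One step of DSA *)

(** The state at time [t] is determined by the draws before [t]; this is what conditioning on the
    past amounts to here. *)
Lemma dsa_eq_history {R : realType} {N p : nat} {q : 'I_N -> nat}
    (F : forall n : 'I_N, 'I_(q n) -> 'rV[R]_p -> R) (W Wt U : 'M[R]_N) (alpha : R)
    (x0 : 'M[R]_(N, p)) (ch ch' : nat -> choice_t q) (t : nat) :
  (forall s, (s < t)%N -> ch s = ch' s) ->
  dsa F W Wt U alpha x0 ch t = dsa F W Wt U alpha x0 ch' t.
Proof.
elim: t => [|t IH] h; first by [].
rewrite /= h; last exact: ltnSn.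
by rewrite IH // => s st; apply: h; exact: ltnW.
Qed.

Lemma dsa_v_range {R : realType} {N p : nat} {q : 'I_N -> nat}
    (F : forall n : 'I_N, 'I_(q n) -> 'rV[R]_p -> R) (W Wt U : 'M[R]_N) (alpha : R)
    (x0 : 'M[R]_(N, p)) (ch : nat -> choice_t q) (t : nat) :
  exists w, st_v (dsa F W Wt U alpha x0 ch t) = U *m w.
Proof.
elim: t => [|t [w IH]] /=; first by exists x0.
by rewrite IH -mulmxDr; eexists.
Qed.

Lemma dsa_primal_dual {R : realType} {N p : nat} {q : 'I_N -> nat}
    (F : forall n : 'I_N, 'I_(q n) -> 'rV[R]_p -> R) (W Wt U : 'M[R]_N) (alpha : R)
    (x0 : 'M[R]_(N, p)) (ch : nat -> choice_t q) (t : nat) (j : choice_t q) :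
  U *m U = Wt - W ->
  let s := dsa F W Wt U alpha x0 ch t in
  st_x (dsa_step F W Wt U alpha t s j) =
  Wt *m st_x s - alpha *: ghat F s j - U *m st_v s.
Proof.
move=> UU; elim: t j => [|t IH] j /=.
  (* At time 0 the dual variable is [U x0], so [Wt x0 - U (U x0) = W x0], which is the special first
     step. *)
  by rewrite mulmxA UU mulmxBl opprB addrAC [_ + (W *m _ - _)]addrC subrK.
have := IH (ch t); rewrite /=; set s := dsa _ _ _ _ _ _ _ t.
set x := (if _ then _ else _) => Ex.
set g := ghat _ _ j; set g' := ghat _ _ (ch t).
(* The induction hypothesis is solved for [U v^t], and [U *m U = Wt - W] handles the increment of
   the dual variable. *)
have -> : U *m (st_v s + U *m x) = Wt *m st_x s - alpha *: g' - x + (Wt *m x - W *m x).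
  rewrite mulmxDr mulmxA UU mulmxBl; congr (_ + _).
  by rewrite Ex opprB [_ + (_ - _)]addrC subrK.
rewrite mulmxDl mul1mx scalerBr.
clearbody x g g'; move: (W *m x) (Wt *m x) (Wt *m st_x s) => a b c.
by apply/matrixP => i k; rewrite !mxE; ring.
Qed.

(* The cross terms in the dual variable cancel, and the gradient noise is
   absorbed by the primal displacement through Young's inequality. *)
Lemma primal_dual_descent {R : realType} {N p : nat} (W Wt U : 'M[R]_N)
    (alpha eta gamma : R) (A A' E g : 'M[R]_(N, p)) :
  U^T = U -> Wt^T = Wt -> U *m U = Wt - W ->
  loewner_le Wt ((2 : R)^-1 *: (1%:M + W)) -> psd (Wt - gamma%:M) ->
  0 < alpha -> 0 < eta ->
  alpha *: g = Wt *m A - A' - U *m E ->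
  mxdot A' (Wt *m A') + mxdot (E + U *m A') (E + U *m A') <=
  mxdot A (Wt *m A) + mxdot E E - (gamma - 2 * alpha * eta) * mxdot (A' - A) (A' - A)
  - 2 * alpha * mxdot A g + alpha / (2 * eta) * mxdot g g.
Proof.
move=> Us Ws UU le gam al0 et0 eg.
(* Once [h1] has bounded [2 <A', Wt A>], what remains in [A'] alone is
   [3 <A', Wt A'> - <A', W A'> - 2 |A'|^2]; by [h2] this is at most [- |U A'|^2], which [h3] shows
   nonpositive. *)
have h1 := mxdot_mulmx_ge0 _ (A' - A) gam.
have h2 := mxdot_mulmx_ge0 _ A' le.
have h3 := mxdot_ge0 (U *m A').
have et2 : 0 < 2 * eta by rewrite mulr_gt0.
have h4 := ler_wpM2l (ltW al0) (mxdot_young (2 * eta) (A' - A) g et2).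
have e1 : mxdot (U *m A') (U *m A') = mxdot A' (Wt *m A') - mxdot A' (W *m A').
  by rewrite -{1}Us -mxdot_mulmx mulmxA UU mulmxBl mxdotDr mxdotNr.
have e2 : alpha * mxdot A' g = mxdot A' (Wt *m A) - mxdot A' A' - mxdot E (U *m A').
  by rewrite -mxdotZr eg !mxdotE [mxdot A' (U *m E)]mxdot_mulmx Us [mxdot (U *m A') E]mxdotC.
have e3 : mxdot A (Wt *m A') = mxdot A' (Wt *m A) by rewrite mxdot_mulmx Ws mxdotC.
have e4 : alpha * ((2 * eta) ^-1 * mxdot g g) = alpha / (2 * eta) * mxdot g g by rewrite mulrA.
move: h1 h2 h4; rewrite !mulmxBl !mulmxBr -scalemxAl mulmxDl mul1mx.
rewrite !mul_scalar_mx !mxdotE e3 [mxdot (U *m A') E]mxdotC [mxdot A A']mxdotC.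
move: e1 e2 h3 e4; lra.
Qed.

(** The recursion expresses [U (U w)] through [A], [A' - A] and [g]; the range bound then recovers
    [|U w|]. [C] depends on none of the iterates, which makes the final rate uniform. *)
Lemma primal_dual_gap_bound {R : realType} {N : nat} (p : nat) (Wt U : 'M[R]_N)
    (alpha : R) :
  U^T = U ->
  exists2 C : R, 0 <= C & forall A A' w g : 'M[R]_(N, p),
    alpha *: g = Wt *m A - A' - U *m (U *m w) ->
    mxdot A (Wt *m A) + mxdot (U *m w) (U *m w) <=
    C * (mxdot A A + mxdot (A' - A) (A' - A) + mxdot g g).
Proof.
move=> Us; have [K K0 hK] := symmetric_range_bound U Us.
pose B := mxdot (Wt - 1%:M) (Wt - 1%:M); pose B' := mxdot Wt Wt.
have B0 : 0 <= B := mxdot_ge0 _.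
have B'0 : 0 <= B' := mxdot_ge0 _.
exists (1 + B' + K * (4 * B + 4 + 2 * alpha ^+ 2)) => [|A A' w g eg].
  have := sqr_ge0 alpha; move: B0 B'0; clearbody B B' => B0 B'0 al0.
  by rewrite addr_ge0 // ?mulr_ge0 //; lra.
have a0 := mxdot_ge0 A; have d0 := mxdot_ge0 (A' - A); have g0 := mxdot_ge0 g.
have h1 : mxdot A (Wt *m A) <= (1 + B') * mxdot A A.
  have := mxdot_young 1 A (- (Wt *m A)) ltr01.
  have := mxdot_mulmx_le Wt p A; rewrite -/B'.
  have := mulr_ge0 B'0 a0.
  rewrite !mxdotE invr1; lra.
have h2 : mxdot (U *m (U *m w)) (U *m (U *m w)) <=
    4 * B * mxdot A A + 4 * mxdot (A' - A) (A' - A) + 2 * alpha ^+ 2 * mxdot g g.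
  have -> : U *m (U *m w) = ((Wt - 1%:M) *m A - (A' - A)) - alpha *: g.
    rewrite eg mulmxBl mul1mx.
    by apply/matrixP => a b; rewrite !mxE; ring.
  have := mxdot_sqD ((Wt - 1%:M) *m A - (A' - A)) (- (alpha *: g)).
  have := mxdot_sqD ((Wt - 1%:M) *m A) (- (A' - A)).
  have := mxdot_mulmx_le (Wt - 1%:M) p A; rewrite -/B.
  rewrite [mxdot (- (A' - A)) _]mxdotNl [mxdot (A' - A) (- _)]mxdotNr.
  rewrite [mxdot (- (_ *: _)) _]mxdotNl [mxdot (_ *: _) (- _)]mxdotNr mxdotZl mxdotZr.
  set Q1 := mxdot (_ *m _) _; set Q2 := mxdot (_ - _ - _) _; set Q3 := mxdot (_ *m _ - _) _.
  move=> ? ? ?; lra.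
have h3 := le_trans (hK p w) (ler_wpM2l K0 h2).
(* One [C] serves all three squares; the slack is a combination of these nonnegative products. *)
have n1 := mulr_ge0 B'0 d0; have n2 := mulr_ge0 B'0 g0.
have n3 := mulr_ge0 K0 a0; have n4 := mulr_ge0 K0 d0; have n5 := mulr_ge0 K0 g0.
have n6 := mulr_ge0 (sqr_ge0 alpha) n3; have n7 := mulr_ge0 (sqr_ge0 alpha) n4.
have n8 := mulr_ge0 B0 n4; have n9 := mulr_ge0 B0 n5.
apply: le_trans (lerD h1 h3) _; rewrite -subr_ge0.
move: a0 d0 g0 n1 n2 n3 n4 n5 n6 n7 n8 n9.
set a := mxdot A A; set d := mxdot (_ - _) _; set e := mxdot g g; nra.
Qed.

(** * Conditional moments of the gradient noise and of [pfun] *)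

Definition smooth_family {R : realType} {N p : nat} {q : 'I_N -> nat}
    (F : forall n : 'I_N, 'I_(q n) -> 'rV[R]_p -> R) (mu L : R) : Prop :=
  forall n (i : 'I_(q n)), [/\ forall x, differentiable (F n i) x,
    strongly_convex mu (F n i) & lipschitz_grad L (F n i)].

Lemma grad_fnode {R : realType} {N p : nat} {q : 'I_N -> nat}
    (F : forall n : 'I_N, 'I_(q n) -> 'rV[R]_p -> R) (mu L : R) (n : 'I_N)
    (x : 'rV[R]_p) :
  smooth_family F mu L ->
  grad (fnode F n) x = (q n)%:R^-1 *: \sum_(i < q n) grad (F n i) x.
Proof.
move=> sm; have df i : differentiable (F n i) x by have [] := sm n i.
have dv i v : derivable (F n i) x v by exact: diff_derivable.
have fE : fnode F n = (q n)%:R^-1 *: \sum_(i < q n) F n i.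
  by apply/funext => y; rewrite /fnode fctE fct_sumE.
apply/rowP => k; rewrite fE mxE -deriveE; last first.
  by apply: differentiableZ; exact: differentiable_sum.
rewrite deriveZ; last exact: derivable_sum.
rewrite derive_sum // mxE summxE; congr (_ * _); apply: eq_bigr => i _.
by rewrite mxE -deriveE.
Qed.

(** The Bregman divergence of the global f between the current iterate and the consensus optimum:
    [pfun] with every stored point replaced by the current one. *)
Definition gap {R : realType} {N p : nat} {q : 'I_N -> nat}
    (F : forall n : 'I_N, 'I_(q n) -> 'rV[R]_p -> R) (s : state R p q)
    (xs : 'rV[R]_p) : R :=
  \sum_(n < N) (q n)%:R^-1 * \sum_(i < q n) bregman (F n i) (row n (st_x s)) xs.

(** Block [n] of [ghat - grad f(xs)] when node [n] draws [i], with each gradient centred at [xs] to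
    match the shape of [saga_second_moment]. *)
Definition gnoise {R : realType} {N p : nat} {q : 'I_N -> nat}
    (F : forall n : 'I_N, 'I_(q n) -> 'rV[R]_p -> R) (s : state R p q)
    (xs : 'rV[R]_p) (n : 'I_N) (i : 'I_(q n)) : 'rV[R]_p :=
  (grad (F n i) (row n (st_x s)) - grad (F n i) xs)
  - (grad (F n i) (st_y s i) - grad (F n i) xs)
  + (q n)%:R^-1 *: \sum_(k < q n) (grad (F n k) (st_y s k) - grad (F n k) xs).

Lemma row_ghat_sub {R : realType} {N p : nat} {q : 'I_N -> nat}
    (F : forall n : 'I_N, 'I_(q n) -> 'rV[R]_p -> R) (mu L : R) (s : state R p q)
    (xs : 'rV[R]_p) (j : choice_t q) (n : 'I_N) :
  smooth_family F mu L ->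
  row n (ghat F s j - \matrix_(n < N) grad (fnode F n) xs) = gnoise F s xs n (j n).
Proof.
move=> sm; rewrite linearB /= !rowK (grad_fnode F mu L n xs sm) /gnoise.
rewrite sumrB scalerBr addrA; congr (_ + _ - _).
by rewrite opprB addrA subrK.
Qed.

Lemma choice_mean_noise_sqr {R : realType} {N p : nat} {q : 'I_N -> nat}
    (F : forall n : 'I_N, 'I_(q n) -> 'rV[R]_p -> R) (mu L : R) (s : state R p q)
    (xs : 'rV[R]_p) :
  choice_t q -> (forall n, (0 < q n)%N) -> 0 <= mu -> 0 < L -> smooth_family F mu L ->
  choice_mean (fun j => let g := ghat F s j - \matrix_(n < N) grad (fnode F n) xs in
    mxdot g g) <= 4 * L * (gap F s xs + pfun F s xs).
Proof.
move=> j0 q0 mu0 L0 sm.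
pose h n i := mxdot (gnoise F s xs n i) (gnoise F s xs n i).
have -> : choice_mean (fun j => let g := ghat F s j - \matrix_(n < N) grad (fnode F n) xs in
    mxdot g g) = choice_mean (fun j => \sum_(n < N) h n (j n)).
  congr (_ * _); apply: eq_bigr => j _; rewrite /= mxdot_rows.
  by apply: eq_bigr => n _; rewrite (row_ghat_sub F mu L).
rewrite choice_mean_coords // /gap /pfun -big_split mulr_sumr; apply: ler_sum => n _ /=.
rewrite -mulrDr mulrCA ler_wpM2l ?invr_ge0 ?ler0n //.
have := saga_second_moment (fun i => grad (F n i) (row n (st_x s)) - grad (F n i) xs)
  (fun i => grad (F n i) (st_y s i) - grad (F n i) xs) _ (q0 n) erefl.
move/le_trans; apply; rewrite mulrDr; apply: lerD.
  rewrite !mulr_sumr; apply: ler_sum => i _; have [df sc lip] := sm n i.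
  have := grad_sub_sqr_le mu L (F n i) xs (row n (st_x s)) mu0 L0 df sc lip.
  by move/(ler_wpM2l (ler0n R 2)); rewrite mulrA mulrA -natrM.
rewrite !mulr_sumr; apply: ler_sum => i _; have [df sc lip] := sm n i.
have := grad_sub_sqr_le mu L (F n i) xs (st_y s i) mu0 L0 df sc lip.
by move/(ler_wpM2l (ler0n R 2)); rewrite mulrA mulrA -natrM.
Qed.

Lemma choice_mean_noise_dot {R : realType} {N p : nat} {q : 'I_N -> nat}
    (F : forall n : 'I_N, 'I_(q n) -> 'rV[R]_p -> R) (mu L : R) (s : state R p q)
    (xs : 'rV[R]_p) :
  choice_t q -> (forall n, (0 < q n)%N) -> 0 <= mu -> 0 < L -> smooth_family F mu L ->
  2 * mu / L * gap F s xs <=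
  choice_mean (fun j => mxdot (st_x s - \matrix_(n < N) xs)
    (ghat F s j - \matrix_(n < N) grad (fnode F n) xs)).
Proof.
move=> j0 q0 mu0 L0 sm.
pose h n i := mxdot (row n (st_x s) - xs) (gnoise F s xs n i).
have -> : choice_mean (fun j => mxdot (st_x s - \matrix_(n < N) xs)
    (ghat F s j - \matrix_(n < N) grad (fnode F n) xs))
    = choice_mean (fun j => \sum_(n < N) h n (j n)).
  congr (_ * _); apply: eq_bigr => j _; rewrite /= mxdot_rows.
  apply: eq_bigr => n _; rewrite (row_ghat_sub F mu L) // /h; congr mxdot.
  by rewrite linearB /= rowK.
rewrite choice_mean_coords // /gap mulr_sumr; apply: ler_sum => n _ /=.
rewrite mulrCA ler_wpM2l ?invr_ge0 ?ler0n //.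
have kne : (q n)%:R != 0 :> R by rewrite pnatr_eq0 -lt0n.
(* Unbiasedness: summed over [i], the stored gradients cancel against their average. *)
have -> : \sum_i h n i = \sum_i mxdot (row n (st_x s) - xs)
    (grad (F n i) (row n (st_x s)) - grad (F n i) xs).
  rewrite -!mxdot_sumr; congr mxdot; rewrite /gnoise big_split /= sumr_const card_ord.
  by rewrite -scaler_nat scalerA divff // scale1r sumrB subrK.
rewrite mulr_sumr; apply: ler_sum => i _; have [df sc lip] := sm n i.
exact: grad_monotone.
Qed.

Lemma choice_mean_pfun {R : realType} {N p : nat} {q : 'I_N -> nat}
    (F : forall n : 'I_N, 'I_(q n) -> 'rV[R]_p -> R) (W Wt U : 'M[R]_N)
    (alpha mu L : R) (t : nat) (s : state R p q) (xs : 'rV[R]_p) (qmin qmax : nat) :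
  choice_t q -> (0 < qmin)%N -> (forall n, (qmin <= q n <= qmax)%N) ->
  0 <= mu -> smooth_family F mu L ->
  choice_mean (fun j => pfun F (dsa_step F W Wt U alpha t s j) xs) <=
  (1 - qmax%:R^-1) * pfun F s xs + qmin%:R^-1 * gap F s xs.
Proof.
move=> j0 qm0 qb mu0 sm.
have q0 n : (0 < q n)%N by have /andP[+ _] := qb n; exact: leq_trans.
pose bx n (i : 'I_(q n)) := bregman (F n i) (row n (st_x s)) xs.
pose bY n (i : 'I_(q n)) := bregman (F n i) (st_y s i) xs.
have b0 n (i : 'I_(q n)) y : 0 <= bregman (F n i) y xs.
  by have [df sc _] := sm n i; exact: bregman_ge0 mu0 (df _) sc.
(* The change in [pfun] caused by node [n] drawing [i]: one stored divergence is replaced by the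
   current one. *)
pose h n (i : 'I_(q n)) := (q n)%:R^-1 * (bx n i - bY n i).
have -> : choice_mean (fun j => pfun F (dsa_step F W Wt U alpha t s j) xs) =
    choice_mean (fun j => pfun F s xs + \sum_(n < N) h n (j n)).
  congr (_ * _); apply: eq_bigr => j _.
  rewrite /pfun -big_split; apply: eq_bigr => n _ /=; rewrite -mulrDr; congr (_ * _).
  rewrite (bigD1 (j n)) //= [in RHS](bigD1 (j n)) //= eqxx.
  rewrite -[in RHS]addrA [in RHS]addrCA [RHS]addrC.
  rewrite -/(bregman _ _ _) -/(bregman (F n (j n)) (st_y s (j n)) xs) /bx /bY addrCA.
  rewrite subrr addr0; congr (_ + _).
  by apply: eq_bigr => i /negbTE ->.
rewrite choice_meanD choice_mean_cst // choice_mean_coords //.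
rewrite mulrBl mul1r -!addrA lerD2l addrC.
have -> : pfun F s xs = \sum_(n < N) (q n)%:R^-1 * \sum_i bY n i by [].
rewrite /gap !mulr_sumr -sumrB; apply: ler_sum => n _.
rewrite -mulr_sumr sumrB.
have /andP[qmi qma] := qb n.
have sx : 0 <= \sum_i bx n i by apply: sumr_ge0 => i _; exact: b0.
have sy : 0 <= \sum_i bY n i by apply: sumr_ge0 => i _; exact: b0.
have iq : 0 <= (q n)%:R^-1 :> R by rewrite invr_ge0.
have i1 : (q n)%:R^-1 <= qmin%:R^-1 :> R by rewrite lef_pV2 ?posrE ?ltr0n // ler_nat.
have i2 : qmax%:R^-1 <= (q n)%:R^-1 :> R.
  by rewrite lef_pV2 ?posrE ?ltr0n ?ler_nat // (leq_trans (q0 n)).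
have := ler_wpM2r (mulr_ge0 iq sx) i1; have := ler_wpM2r (mulr_ge0 iq sy) i2.
rewrite /bx; lra.
Qed.

(** Strong convexity averaged over the functions of each node; it trades the primal distance for
    [gap]. *)
Lemma sqr_dist_le_gap {R : realType} {N p : nat} {q : 'I_N -> nat}
    (F : forall n : 'I_N, 'I_(q n) -> 'rV[R]_p -> R) (mu L : R) (s : state R p q)
    (xs : 'rV[R]_p) :
  (forall n, (0 < q n)%N) -> smooth_family F mu L ->
  let A := st_x s - \matrix_(n < N) xs in
  mu / 2 * mxdot A A <= gap F s xs.
Proof.
move=> q0 sm /=; rewrite mxdot_rows mulr_sumr; apply: ler_sum => n _.
have kp : 0 < (q n)%:R :> R by rewrite ltr0n.
rewrite -(ler_pM2l kp) mulVKf ?gt_eqF // mulr_natl -{1}[q n]card_ord -sumr_const.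
apply: ler_sum => i _; rewrite linearB /= rowK; have [df sc _] := sm n i.
exact: strongly_convex_bregman.
Qed.

Lemma pfun_ge0 {R : realType} {N p : nat} {q : 'I_N -> nat}
    (F : forall n : 'I_N, 'I_(q n) -> 'rV[R]_p -> R) (mu L : R) (s : state R p q)
    (xs : 'rV[R]_p) :
  0 <= mu -> smooth_family F mu L -> 0 <= pfun F s xs.
Proof.
move=> mu0 sm; apply: sumr_ge0 => n _; rewrite mulr_ge0 ?invr_ge0 //.
apply: sumr_ge0 => i _; have [df sc _] := sm n i; exact: bregman_ge0 mu0 (df _) sc.
Qed.

Lemma Gnorm2E {R : realType} {N p : nat} {q : 'I_N -> nat} (Wt : 'M[R]_N)
    (s : state R p q) (xs : 'rV[R]_p) (vs : 'M[R]_(N, p)) :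
  let A := st_x s - \matrix_(n < N) xs in
  Gnorm2 Wt s xs vs = mxdot A (Wt *m A) + mxdot (st_v s - vs) (st_v s - vs).
Proof.
rewrite /Gnorm2 /=; set A := st_x s - _; congr (_ + _); rewrite mxdot_rows.
  apply: eq_bigr => n _; rewrite row_mul mulmx_sum_row mxdot_sumr.
  by apply: eq_bigr => m _; rewrite mxdotZr mxE dotvE.
by apply: eq_bigr => n _; rewrite dotvE.
Qed.

Lemma bigminn_le {N : nat} (q : 'I_N -> nat) (m : nat) (n : 'I_N) :
  (\big[minn/m]_(i < N) q i <= q n)%N.
Proof.
have : n \in index_enum 'I_N by rewrite mem_index_enum.
elim: index_enum => //= i r IH; rewrite inE big_cons => /predU1P[->|/IH h].
  exact: geq_minl.
exact: leq_trans (geq_minr _ _) h.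
Qed.

Lemma bigminn_gt0 {N : nat} (q : 'I_N -> nat) (m : nat) :
  (0 < m)%N -> (forall n, (0 < q n)%N) -> (0 < \big[minn/m]_(i < N) q i)%N.
Proof. by move=> m0 q0; elim/big_ind: _ => // a b a0 b0; rewrite leq_min a0. Qed.

(** * Consensus vectors, choice of the rate, and the contraction *)

(** The consensus stack is the outer product of the all-ones column with [xs], so conditions on
    span(1) carry over to it. *)
Lemma mulmx_consensus {R : realType} {N p : nat} (M : 'M[R]_N) (xs : 'rV[R]_p) :
  M *m (\matrix_(n < N) xs) = M *m const_mx 1 *m xs.
Proof.
rewrite -mulmxA; congr (_ *m _); apply/matrixP => i j; rewrite !mxE big_ord1.
by rewrite !mxE mul1r.
Qed.

Lemma psd_sqrt_const {R : realType} {N : nat} (M U : 'M[R]_N) :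
  is_psd_sqrt M U -> M *m (const_mx 1 : 'cV[R]_N) = 0 ->
  U *m (const_mx 1 : 'cV[R]_N) = 0.
Proof.
move=> [Us [_ UU]] M1; apply: mxdot_eq0.
by rewrite mxdot_mulmx Us mulmxA UU M1 mxdotC mxdot0r.
Qed.

Lemma common_rate {R : realType} (a1 a2 a3 b1 b2 b3 : R) :
  0 <= a1 -> 0 <= a2 -> 0 <= a3 -> 0 < b1 -> 0 < b2 -> 0 < b3 ->
  exists d : R, [/\ 0 < d, d < 1, d * a1 <= b1, d * a2 <= b2 & d * a3 <= b3].
Proof.
move=> a10 a20 a30 b10 b20 b30.
pose b := Num.min 1 (Num.min b1 (Num.min b2 b3)).
have b0 : 0 < b by rewrite !lt_min ltr01 b10 b20 b30.
have [bl1 bl2 bl3 bl4] : [/\ b <= 1, b <= b1, b <= b2 & b <= b3].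
  by split; rewrite /b !ge_min lexx ?orbT.
(* The denominator dominates every [ai], and the summand 2 keeps the rate below 1. *)
have T0 : 0 < 2 + a1 + a2 + a3 by lra.
have step x y : 0 <= x -> x <= 2 + a1 + a2 + a3 -> b <= y ->
    b / (2 + a1 + a2 + a3) * x <= y.
  move=> x0 xT bY; apply: le_trans bY.
  by rewrite mulrAC ler_pdivrMr // ler_pM2l.
exists (b / (2 + a1 + a2 + a3)); split; try (apply: step; lra).
  by rewrite divr_gt0.
rewrite ltr_pdivrMr //; lra.
Qed.

(** Adding [d] times the gap bound to the descent inequality creates the factor [1 - d]; the
    condition on [d * C] lets the displacement term absorb its share. It holds for every draw,
    before averaging. *)
Lemma dsa_pathwise_descent {R : realType} {N p : nat} {q : 'I_N -> nat}
    (F : forall n : 'I_N, 'I_(q n) -> 'rV[R]_p -> R) (W Wt U : 'M[R]_N)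
    (alpha eta gamma : R) (xs : 'rV[R]_p) (vs : 'M[R]_(N, p)) :
  U^T = U -> Wt^T = Wt -> U *m U = Wt - W ->
  loewner_le Wt ((2 : R)^-1 *: (1%:M + W)) -> psd (Wt - gamma%:M) ->
  0 < alpha -> 0 < eta ->
  Wt *m (\matrix_(n < N) xs) = \matrix_(n < N) xs -> U *m (\matrix_(n < N) xs) = 0 ->
  (exists w, vs = U *m w) ->
  alpha *: (\matrix_(n < N) grad (fnode F n) xs) + U *m vs = 0 ->
  exists2 C : R, 0 <= C &
  forall (x0 : 'M[R]_(N, p)) (ch : nat -> choice_t q) (t : nat) (j : choice_t q) (d : R),
    0 <= d -> d * C <= gamma - 2 * alpha * eta ->
    let s := dsa F W Wt U alpha x0 ch t in
    let A := st_x s - \matrix_(n < N) xs in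
    let g := ghat F s j - \matrix_(n < N) grad (fnode F n) xs in
    Gnorm2 Wt (dsa_step F W Wt U alpha t s j) xs vs <=
    (1 - d) * Gnorm2 Wt s xs vs + d * C * mxdot A A - 2 * alpha * mxdot A g
    + (alpha / (2 * eta) + d * C) * mxdot g g.
Proof.
move=> Us Ws UU le gam al0 et0 WX UX [w vsE] opt.
have [C C0 hC] := primal_dual_gap_bound p Wt U alpha Us; exists C => // x0 ch t j d d0 dC /=.
have := dsa_primal_dual F W Wt U alpha x0 ch t j UU; cbv zeta.
have [w' vE] := dsa_v_range F W Wt U alpha x0 ch t.
rewrite !Gnorm2E.
have -> : st_v (dsa_step F W Wt U alpha t (dsa F W Wt U alpha x0 ch t) j) =
  st_v (dsa F W Wt U alpha x0 ch t)
  + U *m st_x (dsa_step F W Wt U alpha t (dsa F W Wt U alpha x0 ch t) j) by [].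
move: (st_x (dsa_step _ _ _ _ _ _ _ _)) vE.
set s := dsa F W Wt U alpha x0 ch t.
move: (ghat F s j) (st_x s) (st_v s) opt => gh x v {s}.
move: (\matrix_n grad (fnode F n) xs) WX UX.
move: (\matrix_(n < N) xs) => X gs WX UX opt x' vE x'E /=.
set A := x - X; set A' := x' - X; set g := gh - gs; set E := v - vs.
have EE : E = U *m (w' - w) by rewrite /E vE vsE mulmxBr.
have -> : v + U *m x' - vs = E + U *m A'.
  by rewrite /A' mulmxBr UX subr0 addrAC.
have eg : alpha *: g = Wt *m A - A' - U *m E.
  have -> : alpha *: g = alpha *: gh + U *m vs.
    by rewrite /g scalerBr; congr (_ + _); apply/eqP; rewrite eq_sym -addr_eq0 addrC opt.
  rewrite /A /A' /E !mulmxBr WX x'E.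
  move: (Wt *m x) (U *m v) (U *m vs) (alpha *: gh) => a b c e.
  by apply/matrixP => i k; rewrite !mxE; ring.
have := primal_dual_descent W Wt U alpha eta gamma A A' E g Us Ws UU le gam al0 et0 eg.
have := hC A A' (w' - w) g; rewrite -EE => /(_ eg) /(ler_wpM2l d0).
have := ler_wpM2r (mxdot_ge0 (A' - A)) dC.
clearbody A A' E g; move: (mxdot (E + _) _) (mxdot A' _) => e' a'.
move: (mxdot (A' - A) _) (mxdot g g) (mxdot A g) (mxdot A A) (mxdot A _) (mxdot E E) => *.
lra.
Qed.

Theorem theorem6 (R : realType) (N p : nat) (hN : (0 < N)%N) (hp : (0 < p)%N)
  (adj : rel 'I_N) (adj_sym : symmetric adj) (adj_irr : irreflexive adj)
  (adj_conn : forall m n : 'I_N, connect adj m n)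
  (q : 'I_N -> nat) (hq : forall n, (0 < q n)%N)
  (F : forall n : 'I_N, 'I_(q n) -> 'rV[R]_p -> R) (mu L : R)
  (hmu : 0 < mu) (hL : 0 < L)
  (hdiff : forall n (i : 'I_(q n)) (x : 'rV[R]_p), differentiable (F n i) x)
  (hsc : forall n (i : 'I_(q n)), strongly_convex mu (F n i))
  (hlip : forall n (i : 'I_(q n)), lipschitz_grad L (F n i))
  (W Wt Ur : 'M[R]_N)
  (hWsp : forall m n : 'I_N, W m n != 0 -> m = n \/ adj n m)
  (hWtsp : forall m n : 'I_N, Wt m n != 0 -> m = n \/ adj n m)
  (hWsym : W^T = W) (hWtsym : Wt^T = Wt)
  (hnullWt : null_sup_span1 (1%:M - Wt))
  (hnullW : null_eq_span1 (1%:M - W))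
  (hnullWtW : null_eq_span1 (Wt - W))
  (hle1 : loewner_le W Wt)
  (hle2 : loewner_le Wt ((2 : R)^-1 *: (1%:M + W)))
  (hWtpd : pd Wt)
  (hU : is_psd_sqrt (Wt - W) Ur)
  (gamma : R) (hgamma : smallest_eigenvalue Wt gamma)
  (xs : 'rV[R]_p)
  (hxs : forall x : 'rV[R]_p, \sum_(n < N) fnode F n xs <= \sum_(n < N) fnode F n x)
  (eta alpha c : R)
  (heta : let qmax := (\max_(n < N) q n)%N in
          let qmin := \big[minn/qmax]_(n < N) q n in
          L ^+ 2 * qmax%:R / (mu * qmin%:R) + L ^+ 2 / mu - L < eta)
  (halpha : 0 < alpha < gamma / (2 * eta))
  (hc : let qmax := (\max_(n < N) q n)%N in
        let qmin := \big[minn/qmax]_(n < N) q n in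
        4 * alpha * L * qmax%:R / eta < c <
        4 * alpha * mu * qmin%:R / L - 2 * alpha * qmin%:R * (2 * L - mu) / eta)
  (vs : 'M[R]_(N, p))
  (hvs_col : exists w : 'M[R]_(N, p), vs = Ur *m w)
  (hvs : alpha *: (\matrix_(n < N) grad (fnode F n) xs) + Ur *m vs = 0) :
  exists delta : R, 0 < delta < 1 /\
    forall (x0 : 'M[R]_(N, p)) (ch : nat -> choice_t q) (t : nat),
      cond_exp_next F W Wt Ur alpha x0 ch t (fun s => lyap F Wt c s xs vs)
      <= (1 - delta) * lyap F Wt c (dsa F W Wt Ur alpha x0 ch t) xs vs.
Proof.
set qmax := (\max_(n < N) q n)%N in heta hc *.
set qmin := \big[minn/qmax]_(n < N) q n in heta hc *.
move: hc => /= hc {heta hxs}.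
have sm : smooth_family F mu L by move=> n i; split.
have qle n : (q n <= qmax)%N by exact: (leq_bigmax (F := q)).
have qmax0 : (0 < qmax)%N by exact: leq_trans (hq (Ordinal hN)) (qle _).
have qmin0 : (0 < qmin)%N by exact: bigminn_gt0.
have qb n : (qmin <= q n <= qmax)%N by rewrite qle bigminn_le.
have gam0 := pd_smallest_eigenvalue_gt0 Wt gamma hWtsym hWtpd hgamma.
have Wtpsd : psd Wt.
  move=> u; have [->|/hWtpd/ltW //] := eqVneq u 0.
  by rewrite mulmx0 mxE.
have gampsd := smallest_eigenvalue_psd Wt gamma hWtsym Wtpsd hgamma.
have /andP[al0 al1] := halpha.
have eta0 : 0 < eta.
  have := lt_trans al0 al1; rewrite pmulr_rgt0 // invr_gt0; lra.
have e2 : 0 < gamma - 2 * alpha * eta.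
  by move: al1; rewrite ltr_pdivlMr ?mulr_gt0 //; lra.
have muL : mu <= L.
  have [df sc lip] := sm (Ordinal hN) (Ordinal (hq _)).
  exact: strong_convexity_le_smoothness hp (ltW hmu) (ltW hL) df sc lip.
have one : Wt *m (const_mx 1 : 'cV[R]_N) = const_mx 1.
  by move/eqP: hnullWt; rewrite mulmxBl mul1mx subr_eq0 => /eqP.
have UX : Ur *m (\matrix_(n < N) xs) = 0.
  rewrite mulmx_consensus (psd_sqrt_const _ _ hU) ?mul0mx //.
  by apply/hnullWtW; exists 1; rewrite scale1r.
have WX : Wt *m (\matrix_(n < N) xs) = \matrix_(n < N) xs.
  by rewrite mulmx_consensus one -[const_mx 1]mul1mx -mulmx_consensus mul1mx.
have [Us [_ UU]] := hU.
have [C C0 step] := dsa_pathwise_descent F W Wt Ur alpha eta gamma xs vs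
  Us hWtsym UU hle2 gampsd al0 eta0 WX UX hvs_col hvs.
have QM : 0 < qmax%:R :> R by rewrite ltr0n.
have Qm : 0 < qmin%:R :> R by rewrite ltr0n.
have /andP[c1 c2] := hc.
have r0 : 0 < alpha * L / eta by rewrite divr_gt0 // mulr_gt0.
(* Net decrease available for [pfun]: the lower bound on [c] gives twice what the noise costs. *)
have b2 : 0 < c / qmax%:R - 2 * (alpha * L / eta).
  have -> : c / qmax%:R - 2 * (alpha * L / eta)
    = (c - 4 * alpha * L * qmax%:R / eta) / qmax%:R + 2 * (alpha * L / eta).
    by field; rewrite !gt_eqF.
  by apply: addr_gt0; [rewrite divr_gt0 // subr_gt0|rewrite mulr_gt0].
(* Net decrease available for [gap]: the upper bound on [c] divided by [qmin], with surplus
   [2 alpha (L - mu) / eta]. *)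
have b3 : 0 < 4 * alpha * mu / L - 2 * (alpha * L / eta) - c / qmin%:R.
  have -> : 4 * alpha * mu / L - 2 * (alpha * L / eta) - c / qmin%:R
    = (4 * alpha * mu * qmin%:R / L - 2 * alpha * qmin%:R * (2 * L - mu) / eta - c) / qmin%:R
      + 2 * (alpha / eta * (L - mu)).
    by field; rewrite !gt_eqF.
  rewrite ltr_pwDl ?divr_gt0 ?subr_gt0 // !mulr_ge0 ?subr_ge0 //; first exact: ltW.
  by rewrite invr_ge0 ltW.
have c0 : 0 < c.
  by apply: lt_trans c1; rewrite divr_gt0 // !mulr_gt0.
have LC : 0 <= 4 * L * C by rewrite !mulr_ge0 // ltW.
have a2 : 0 <= c + 4 * L * C by rewrite addr_ge0 // ltW.
have a3 : 0 <= 2 / mu * C + 4 * L * C.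
  by rewrite addr_ge0 // mulr_ge0 // divr_ge0 // ltW.
(* [dC], [dp] and [dg] make [d] affordable for the displacement, for [pfun] and for [gap]
   respectively. *)
have [d [d0 d1 dC dp dg]] := common_rate _ _ _ _ _ _ C0 a2 a3 e2 b2 b3.
exists d; split; first by rewrite d0.
move=> x0 ch t; set s := dsa F W Wt Ur alpha x0 ch t.
have -> : cond_exp_next F W Wt Ur alpha x0 ch t (fun s => lyap F Wt c s xs vs) =
    choice_mean (fun j => lyap F Wt c (dsa_step F W Wt Ur alpha t s j) xs vs).
  (* Overriding the draw at time [t] leaves the state at time [t] unchanged. *)
  congr (_ * _); apply: eq_bigr => j _ /=; rewrite /ch_upd eqxx.
  rewrite (dsa_eq_history F W Wt Ur alpha x0 _ ch) // => k kt.
  by rewrite ltn_eqF.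
pose A := st_x s - \matrix_(n < N) xs.
pose g j := ghat F s j - \matrix_(n < N) grad (fnode F n) xs.
pose k := alpha / (2 * eta) + d * C.
pose G := Gnorm2 Wt s xs vs.
have k0 : 0 <= k.
  by rewrite addr_ge0 // ?mulr_ge0 ?(ltW d0) // ?invr_ge0 ?mulr_ge0 ?(ltW eta0) // ltW.
apply: le_trans (_ : _ <= choice_mean (fun j => ((1 - d) * G + d * C * mxdot A A)
    + (- (2 * alpha) * mxdot A (g j) + (k * mxdot (g j) (g j)
    + c * pfun F (dsa_step F W Wt Ur alpha t s j) xs)))) _.
  apply: choice_mean_le => j; have := step x0 ch t j d (ltW d0) dC.
  by rewrite /lyap -/s -/G -/A -/(g j) -/k; lra.
rewrite !choice_meanD !choice_meanZ !(choice_mean_cst _ (ch t)) /lyap -/G.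
have m1 := choice_mean_noise_dot F mu L s xs (ch t) hq (ltW hmu) hL sm.
have m2 := choice_mean_noise_sqr F mu L s xs (ch t) hq (ltW hmu) hL sm.
have m3 := choice_mean_pfun F W Wt Ur alpha mu L t s xs qmin qmax (ch t) qmin0 qb (ltW hmu) sm.
have m4 := sqr_dist_le_gap F mu L s xs hq sm.
have P0 := pfun_ge0 F mu L s xs (ltW hmu) sm.
move: m1 m2 m3 m4; rewrite /= -/A.
move: (choice_mean _) (choice_mean _) (choice_mean _) (gap F s xs) (pfun F s xs) P0.
move=> Mp Mgg Mg D P P0 m1 m2 m3 m4.
have A0 := mxdot_ge0 A.
have D0 : 0 <= D by apply: le_trans m4; rewrite mulr_ge0 // divr_ge0 // ltW.
have al2 : 0 <= 2 * alpha by rewrite mulr_ge0 // ltW.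
have {m1} := ler_wpM2l al2 m1.
have {m2} := ler_wpM2l k0 m2.
have {m3} := ler_wpM2l (ltW c0) m3.
have {m4} : d * C * mxdot A A <= d * (2 / mu * C) * D.
  have -> : d * (2 / mu * C) * D = d * C * (2 / mu * D) by ring.
  rewrite ler_wpM2l ?mulr_ge0 ?(ltW d0) //.
  rewrite -(ler_pM2l (_ : 0 < mu / 2)) ?divr_gt0 //.
  by apply: le_trans m4 _; rewrite mulrA; have -> : mu / 2 * (2 / mu) = 1
    by [field; rewrite gt_eqF|]; rewrite mul1r.
have := ler_wpM2r P0 dp.
have := ler_wpM2r D0 dg.
(* Separates the noise cost at rate 0 from the part proportional to [d], so that the sum of the
   bounds becomes linear. *)
have -> : k * (4 * L * (D + P)) = 2 * (alpha * L / eta) * (D + P) + d * (4 * L * C) * (D + P).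
  by rewrite /k; field; rewrite gt_eqF.
have -> : 2 * alpha * (2 * mu / L * D) = 4 * alpha * mu / L * D by field; rewrite gt_eqF.
move: (mxdot A A) {A0} (alpha * L / eta) (4 * alpha * mu / L) => aa r u.
lra.
Qed.
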